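(* Let $Y=(Y_t)_{0\le t\le T}$, $L=(L_t)_{0\le t\le T}$ and $U=(U_t)_{0\le t\le T}$ be real-valued rcll $(\mathcal{F}_t)$-adapted processes such that $L_0\le Y_0\le U_0$ and such that, $\mathbb{P}$-a.s., for all $t\in[0,T]$, $L_t<U_t$ and $L_{t^-}<U_{t^-}$. Then the Skorokhod problem $SPR(Y,L,U)$ has a unique solution $(X,K^+,K^-)$.
   Context: Fix $T>0$ and a probability space $(\Omega,\mathcal{F},\mathbb{P})$ with a filtration $(\mathcal{F}_t)_{t\in[0,T]}$ satisfying the usual conditions (completeness and right continuity). ''rcll'' means right continuous with left limits; $X_{t^-}:=\lim_{s\nearrow t}X_s$ denotes the left limit, with the convention $X_{0^-}=X_0$. Equalities and inequalities between processes are understood $\mathbb{P}$-a.s. Definition. For rcll adapted processes $Y,L,U$ with $L\le U$ and $L_0\le Y_0\le U_0$, a triplet of processes $(X,K^+,K^-)$ is a solution of the Skorokhod problem $SPR(Y,L,U)$ if $K^+$ and $K^-$ are rcll, adapted, nonnegative, increasing (i.e. nondecreasing) processes with $K^+_0=K^-_0=0$ and, for all $t\in[0,T]$: (1) $X_t=Y_t+K^+_t-K^-_t$; (2) $L_t\le X_t\le U_t$; (3) $\int_0^T (X_s-L_s)\,dK^+_s=\int_0^T (U_s-X_s)\,dK^-_s=0$, the integrals being pathwise Stieltjes integrals with respect to the increasing processes $K^+$ and $K^-$. Uniqueness is understood up to indistinguishability of each of $X,K^+,K^-$. *)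

(* Defs.v *)
From HB Require Import structures.
From mathcomp Require Export all_boot all_order all_algebra.
From mathcomp Require Export all_classical all_reals all_analysis.
Export Order.TTheory GRing.Theory Num.Theory.
Export numFieldNormedType.Exports.

Set Implicit Arguments.
Unset Strict Implicit.
Unset Printing Implicit Defensive.

Local Open Scope classical_set_scope.
Local Open Scope ring_scope.

(* Time runs over [0, T] with T : R.  Paths and processes are indexed by the
   whole of R, but every condition below only looks at times in [0, T]. *)
Section paths.
Context {R : realType}.
Implicit Types (T t : R) (f g k : R -> R).

Definition rcll_path T f : Prop :=
  (forall t, 0 <= t < T -> f s @[s --> t^'+] --> f t) /\
  (forall t, 0 < t <= T -> exists l : R, f s @[s --> t^'-] --> l).

(* The convention f(0-) = f(0) is built in. *)
Definition left_limit f t : R :=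
  if 0 < t then lim (f s @[s --> t^'-]) else f 0.

Definition increasing_from0 T k : Prop :=
  [/\ k 0 = 0,
      forall t, 0 <= t <= T -> 0 <= k t &
      forall s t, 0 <= s -> s <= t -> t <= T -> k s <= k t].

(* "The integral of g over [0, T] against dk exists as a Lebesgue-Stieltjes
   integral and equals v".  The path k is extended to R as a constant on each
   side of [0, T]; the extension has no jump at 0, so {0} is not charged. The
   integrator F exists (and is unique) exactly when k is nondecreasing and
   right-continuous on [0, T]. *)
Definition is_stieltjes_integral T g k (v : \bar R) : Prop :=
  exists F : cumulative R R,
    (forall t, F t = k (Num.max 0 (Num.min t T))) /\
    (\int[lebesgue_stieltjes_measure F]_(s in `[0%R, T]) (g s)%:E = v)%E.

End paths.

Section processes.
Context {R : realType} {d : measure_display} {Omega : measurableType d}.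
Variable P : probability Omega R.
Implicit Types (T : R) (F : R -> set (set Omega)) (X Y L U : R -> {RV P >-> R}).

Definition filtration T F : Prop :=
  [/\ forall t, 0 <= t <= T -> sigma_algebra [set: Omega] (F t),
      forall t, 0 <= t <= T -> F t `<=` measurable &
      forall s t, 0 <= s -> s <= t -> t <= T -> F s `<=` F t].

(* P.-negligible sets are arbitrary subsets of measurable sets of probability 0,
   so the first condition also makes P a complete measure. *)
Definition usual_conditions T F : Prop :=
  P.-negligible `<=` F 0 /\
  (forall t, 0 <= t < T -> F t = \bigcap_(s in `]t, T]) F s).

(* F t is a sigma-algebra, so it is the sigma-algebra carried by
   g_sigma_algebraType (F t). *)
Definition adapted T F X : Prop :=
  forall t, 0 <= t <= T ->
    measurable_fun [set: g_sigma_algebraType (F t)] (X t : Omega -> R).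

Definition rcll T X : Prop := forall w, rcll_path T (fun t => X t w).

Definition indistinguishable T X Y : Prop :=
  {ae P, forall w, forall t, 0 <= t <= T -> X t w = Y t w}.

Definition SPR_solution T F Y L U (X Kp Km : R -> {RV P >-> R}) : Prop :=
  [/\ [/\ rcll T Kp, adapted T F Kp, rcll T Km & adapted T F Km],
      {ae P, forall w, increasing_from0 T (fun t => Kp t w) /\
                       increasing_from0 T (fun t => Km t w)},
      {ae P, forall w, forall t, 0 <= t <= T -> X t w = Y t w + Kp t w - Km t w},
      {ae P, forall w, forall t, 0 <= t <= T -> L t w <= X t w <= U t w} &
      {ae P, forall w,
         is_stieltjes_integral T (fun s => X s w - L s w) (fun s => Kp s w) 0%E /\
         is_stieltjes_integral T (fun s => U s w - X s w) (fun s => Km s w) 0%E}].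

End processes.

(* Main.v *)
Require Import Defs.
From HB Require Import structures.
From mathcomp Require Import measurable_realfun lra.

(* With X = Y + K+ - K-, the one-sided Skorokhod reflections at L and U say
     K+ = max(0, sup_{s <= .} (L - Y + K-)),  K- = max(0, sup_{s <= .} (Y - U + K+)).
   Existence: iterate this system pathwise from K- = 0. The iterates increase,
   and they stay below any pair (A, B) of nonnegative nondecreasing functions
   with L <= Y + A - B <= U. Such a pair exists: since L < U and L- < U-, near
   each time some Y + constant fits strictly between L and U, so real induction
   produces a step function A - B. The limit is a fixed point, it is
   right-continuous because simultaneous right jumps of K+ and K- would force
   L = U, and K+ (resp. K-) is flat on a right neighbourhood of, and has no jump
   at, each time where X > L (resp. X < U). Every iterate is a running maximum of
   a right-continuous function, hence a supremum over rational times, which gives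
   adaptedness.
   Uniqueness: if X and X' are two solutions with X_t > X'_t, then after the last
   time before t where X <= X' neither K+ nor K'- can grow, a contradiction; so
   X = X', and then the regulators agree because at each time one of the two
   barriers is inactive. *)

Set Implicit Arguments.
Unset Strict Implicit.
Unset Printing Implicit Defensive.

Local Open Scope classical_set_scope.
Local Open Scope ring_scope.

(** * One-sided limits and real induction *)

Section one_sided_limits.
Context {R : realType}.
Implicit Types (f : R -> R) (t a : R).

Lemma at_right_gt f t l a : f s @[s --> t^'+] --> l -> a < l ->
  exists2 d, 0 < d & forall s, t < s <= t + d -> a < f s.
Proof.
move=> fl al; have : \forall s \near t^'+, a < f s by exact: (cvgr_gt _ fl).
rewrite near_withinE => -[d /= d0 H]; exists (d / 2); first by rewrite divr_gt0.
move=> s /andP[ts std]; apply: H => //=.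
by rewrite distrC ger0_norm ?subr_ge0 1?ltW//; lra.
Qed.

Lemma at_left_gt f t l a : f s @[s --> t^'-] --> l -> a < l ->
  exists2 d, 0 < d & forall s, t - d <= s < t -> a < f s.
Proof.
move=> fl al; have : \forall s \near t^'-, a < f s by exact: (cvgr_gt _ fl).
rewrite near_withinE => -[d /= d0 H]; exists (d / 2); first by rewrite divr_gt0.
move=> s /andP[ts std]; apply: H => //=.
by rewrite ger0_norm ?subr_ge0 1?ltW//; lra.
Qed.

Lemma right_continuous_gt f t a : f s @[s --> t^'+] --> f t -> a < f t ->
  exists2 d, 0 < d & forall s, t <= s <= t + d -> a < f s.
Proof.
move=> fl aft; have [d d0 H] := at_right_gt fl aft.
exists d => // s /andP[]; rewrite le_eqVlt => /predU1P[<-//|ts std].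
by apply: H; rewrite ts.
Qed.

Lemma right_continuous_lt f t a : f s @[s --> t^'+] --> f t -> f t < a ->
  exists2 d, 0 < d & forall s, t <= s <= t + d -> f s < a.
Proof.
move=> fl fta; have [||d d0 H] := @right_continuous_gt (\- f) t (- a).
- exact: cvgN.
- by rewrite ltrN2.
by exists d => // s /H; rewrite ltrN2.
Qed.

Lemma nondecreasing_right_continuous f t :
  {homo f : x y / x <= y} ->
  (forall e, 0 < e -> exists2 d, 0 < d & f (t + d) <= f t + e) ->
  f s @[s --> t^'+] --> f t.
Proof.
move=> ndf H; apply/cvgrPdist_le => e e0; have [d d0 ft] := H e e0.
near=> s; rewrite ler0_norm ?subr_le0 ?ndf// opprB lerBlDl.
by apply: le_trans ft; apply: ndf; near: s; apply: nbhs_right_le; rewrite ltrDl.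
Unshelve. all: by end_near. Qed.

(** A failing [t] would bound the set of [s >= 0] with [P s]. The supremum of this set satisfies [P]
    by the base case or the left step, and the right step then goes beyond it. *)
Lemma real_induction (P : R -> Prop) :
  P 0 ->
  (forall s t, 0 <= s <= t -> P t -> P s) ->
  (forall t, 0 <= t -> P t -> exists2 d, 0 < d & P (t + d)) ->
  (forall t, 0 < t -> (forall s, 0 <= s < t -> P s) -> P t) ->
  forall t, 0 <= t -> P t.
Proof.
move=> P0 Pdown Pright Pleft t t0; apply: contrapT => nPt.
pose A := [set s | 0 <= s /\ P s].
have A0 : A 0 by [].
have ubA : ubound A t.
  move=> s [s0 Ps]; rewrite leNgt; apply/negP => ts; apply: nPt.
  by apply: Pdown Ps; rewrite t0 ltW.
have supA : has_sup A by split; [exists 0|exists t].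
have sup0 : 0 <= sup A by apply: ub_le_sup A0; exists t.
have lt_sup s : 0 <= s < sup A -> P s.
  move=> /andP[s0 sA]; have [|r [r0 Pr] sr] := sup_gt _ sA; first by exists 0.
  by apply: Pdown Pr; rewrite s0 ltW.
have PsA : P (sup A).
  have [A1|] := ltrP 0 (sup A); first exact: Pleft.
  by move=> s0; rewrite (_ : sup A = 0) //; apply/le_anti; rewrite s0.
have [d d0 Pd] := Pright _ sup0 PsA.
suff : sup A + d <= sup A by rewrite leNgt ltrDl d0.
by apply: ub_le_sup; [exists t|split => //; rewrite addr_ge0// ltW].
Qed.

End one_sided_limits.

(** * Running maxima and their points of increase *)

Section running_max.
Context {R : realType}.
Implicit Types (f k y l u : R -> R) (t : R).

Definition running_max f t : R := sup [set Num.max 0 (f s) | s in [set s | s <= t]].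

(* [k t = max(0, sup_{s <= t} f s)], stated without [sup]. *)
Definition is_running_max f k := forall t M,
  k t <= M <-> 0 <= M /\ forall s, s <= t -> f s <= M.

(** [sup] takes a default value on unbounded sets; the nondecreasing majorant [A] makes this
    supremum genuine. *)
Lemma running_maxP f (A : R -> R) : {homo A : s t / s <= t} ->
  (forall t, f t <= A t) -> is_running_max f (running_max f).
Proof.
move=> ndA fA t M; have ub : has_ubound [set Num.max 0 (f s) | s in [set s | s <= t]].
  exists (Num.max 0 (A t)) => _ [s /= st <-]; rewrite ge_max le_max lexx/=.
  by rewrite le_max; apply/orP; right; apply: le_trans (fA s) _; exact: ndA.
split=> [tM|[M0 fM]].
  have H s : s <= t -> Num.max 0 (f s) <= M.
    by move=> st; apply: le_trans tM; apply: ub_le_sup => //; exists s.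
  split; first by have := H _ (lexx t); rewrite ge_max => /andP[].
  by move=> s /H; rewrite ge_max => /andP[].
apply: ge_sup; first by exists (Num.max 0 (f t)), t => /=.
by move=> _ [s /= st <-]; rewrite ge_max M0 fM.
Qed.

Section properties.
Variables (f k : R -> R).
Hypothesis fk : is_running_max f k.

Lemma running_max_ge0 t : 0 <= k t. Proof. by have [] := (fk t (k t)).1 (lexx _). Qed.

Lemma running_max_ge s t : s <= t -> f s <= k t.
Proof. by have [_] := (fk t (k t)).1 (lexx _); apply. Qed.

Lemma running_max_nd : {homo k : s t / s <= t}.
Proof.
move=> s t st; apply/fk; split; first exact: running_max_ge0.
by move=> r rs; apply: running_max_ge; exact: le_trans st.
Qed.

(** By right-continuity [f] stays below [k t] for a while after [t], so no new maximum is reached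
    there. *)
Lemma running_max_flat_right t : f s @[s --> t^'+] --> f t -> f t < k t ->
  exists2 d, 0 < d & k (t + d) = k t.
Proof.
move=> fc ft; have [d d0 H] := right_continuous_lt fc ft.
exists d => //; apply/le_anti/andP; split; last by rewrite running_max_nd// lerDl ltW.
apply/fk; split=> [|s std]; first exact: running_max_ge0.
have [st|ts] := leP s t; first exact: running_max_ge.
by apply/ltW/H; rewrite std ltW.
Qed.

(** If [k] gained at least [e] at [t], then the maximum of [f t] and [k t - e], which lies below
    [k t], would already bound [f] up to [t]. *)
Lemma running_max_continuous_left t e : f t < k t -> 0 < e ->
  exists2 s, s < t & k t - e < k s.
Proof.
move=> ft e0; apply: contrapT => H.
have {}H s : s < t -> k s <= k t - e.
  by move=> st; rewrite leNgt; apply/negP => ?; apply: H; exists s.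
(* If [k t <= 0], then [k (t - 1) <= k t - e] would be negative. *)
have [k0|] := ltP 0 (k t); last first.
  move=> k0; have := H (t - 1); have := running_max_ge0 (t - 1); lra.
have : k t <= Num.max (f t) (k t - e); last by rewrite le_max; lra.
apply/fk; split=> [|s].
  rewrite le_max; apply/orP; right.
  by apply: le_trans (running_max_ge0 (t - 1)) _; apply: H; lra.
rewrite le_eqVlt le_max => /predU1P[->|st]; first by rewrite lexx.
by apply/orP; right; apply: le_trans (running_max_ge (lexx s)) _; exact: H.
Qed.

End properties.

Lemma running_max_right_continuous f k : is_running_max f k ->
  (forall t, f s @[s --> t^'+] --> f t) -> forall t, k s @[s --> t^'+] --> k t.
Proof.
move=> fk fc t; apply: nondecreasing_right_continuous; first exact: running_max_nd fk.
move=> e e0; have ft : f t < k t + e by rewrite ltr_pwDr// (running_max_ge fk).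
have [d d0 H] := right_continuous_lt (fc t) ft; exists d => //.
apply/fk; split=> [|s std]; first by rewrite addr_ge0 ?(running_max_ge0 fk)// ltW.
have [st|ts] := leP s t; last by apply/ltW/H; rewrite std ltW.
by rewrite (le_trans (running_max_ge fk st))// lerDl ltW.
Qed.

End running_max.

(** * Monotone iteration between two barriers *)

Section two_barriers.
Context {R : realType}.
Implicit Types (y l u : R -> R) (t : R).

(** The regulator of the one-sided Skorokhod reflection of [y - m] at the lower barrier [l];
    [push_down] is that of [y + p] at the upper barrier [u]. *)
Definition push_up y l (m : R -> R) := running_max (fun s => l s - y s + m s).
Definition push_down y u (p : R -> R) := running_max (fun s => y s - u s + p s).

Definition minus_iter y l u n : R -> R :=
  iter n (fun m => push_down y u (push_up y l m)) (cst 0).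
Definition plus_iter y l u n : R -> R := push_up y l (minus_iter y l u n).

Definition minus_reg y l u t : R := sup (range (fun n => minus_iter y l u n t)).
Definition plus_reg y l u t : R := sup (range (fun n => plus_iter y l u n t)).

Lemma sup_range_le (z : nat -> R) (b M : R) : (forall n, z n <= b) ->
  sup (range z) <= M <-> forall n, z n <= M.
Proof.
move=> zb; split=> [zM n|zM].
  by apply: le_trans zM; apply: ub_le_sup; [exists b => _ [k _ <-]|exists n].
by apply: ge_sup; [exists (z 0%N), 0%N|move=> _ [n _ <-]].
Qed.

(* [A] and [B] form a supersolution; the iterates stay below it. *)
Section convergence.
Variables (y l u A B : R -> R).
Hypotheses (ndA : {homo A : s t / s <= t}) (ndB : {homo B : s t / s <= t}).
Hypotheses (A_ge0 : forall t, 0 <= A t) (B_ge0 : forall t, 0 <= B t).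
Hypothesis lABu : forall t, l t <= y t + A t - B t <= u t.

(** Since [m <= B], the input [l - y + m] is at most [A], and the nondecreasing [A] then dominates
    the running maximum as well. *)
Lemma push_upP m : (forall t, m t <= B t) ->
  is_running_max (fun s => l s - y s + m s) (push_up y l m) /\
  forall t, push_up y l m t <= A t.
Proof.
move=> mB; have fA t : l t - y t + m t <= A t by have := mB t; have := lABu t; lra.
have rm := running_maxP ndA fA; split=> // t; apply/rm; split=> // s st.
by apply: le_trans (fA s) _; exact: ndA.
Qed.

Lemma push_downP p : (forall t, p t <= A t) ->
  is_running_max (fun s => y s - u s + p s) (push_down y u p) /\
  forall t, push_down y u p t <= B t.
Proof.
move=> pA; have fB t : y t - u t + p t <= B t by have := pA t; have := lABu t; lra.
have rm := running_maxP ndB fB; split=> // t; apply/rm; split=> // s st.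
by apply: le_trans (fB s) _; exact: ndB.
Qed.

Lemma minus_iter_le n t : minus_iter y l u n t <= B t.
Proof.
elim: n t => [|n IHn] t //=.
by have [_ +] := push_upP IHn => /push_downP[_]; apply.
Qed.

Lemma plus_iterP n :
  is_running_max (fun s => l s - y s + minus_iter y l u n s) (plus_iter y l u n).
Proof. by have [] := push_upP (minus_iter_le n). Qed.

Lemma plus_iter_le n t : plus_iter y l u n t <= A t.
Proof. by have [_] := push_upP (minus_iter_le n); apply. Qed.

Lemma minus_iterSP n :
  is_running_max (fun s => y s - u s + plus_iter y l u n s) (minus_iter y l u n.+1).
Proof. by have [] := push_downP (plus_iter_le n). Qed.

Lemma minus_reg_le t M :
  minus_reg y l u t <= M <-> forall n, minus_iter y l u n t <= M.
Proof. by apply: sup_range_le => n; exact: minus_iter_le. Qed.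

Lemma plus_reg_le t M :
  plus_reg y l u t <= M <-> forall n, plus_iter y l u n t <= M.
Proof. by apply: sup_range_le => n; exact: plus_iter_le. Qed.

(** The suprema over [n] and over [s <= t] commute, so the limit passes through the running
    maximum. *)
Lemma plus_regP :
  is_running_max (fun s => l s - y s + minus_reg y l u s) (plus_reg y l u).
Proof.
move=> t M; rewrite plus_reg_le; split=> [H|[M0 H] n].
  split; first exact: le_trans (running_max_ge0 (@plus_iterP 0) t) (H 0%N).
  move=> s st; rewrite -lerBrDl; apply/minus_reg_le => n; rewrite lerBrDl.
  by have /plus_iterP[_] := H n; apply.
apply/plus_iterP; split=> // s /H; rewrite -!lerBrDl => /minus_reg_le; exact.
Qed.

Lemma minus_regP :
  is_running_max (fun s => y s - u s + plus_reg y l u s) (minus_reg y l u).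
Proof.
move=> t M; rewrite minus_reg_le; split=> [H|[M0 H] n].
  split; first exact: (H 0%N).
  move=> s st; rewrite -lerBrDl; apply/plus_reg_le => n; rewrite lerBrDl.
  by have /minus_iterSP[_] := H n.+1; apply.
(* The iterate of index 0 is the constant 0, bounded by [0 <= M]; only the later ones are running
   maxima of the stated form. *)
case: n => // n.
apply/minus_iterSP; split=> // s /H; rewrite -!lerBrDl => /plus_reg_le; exact.
Qed.

End convergence.

Section fixed_point.
Variables (y l u p m : R -> R).
Hypotheses (yc : forall t, y s @[s --> t^'+] --> y t)
  (lc : forall t, l s @[s --> t^'+] --> l t)
  (uc : forall t, u s @[s --> t^'+] --> u t).
Hypothesis lu : forall t, l t < u t.
Hypotheses (pP : is_running_max (fun s => l s - y s + m s) p)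
  (mP : is_running_max (fun s => y s - u s + p s) m).

(* Right jumps of [p] and [m] at [t] would have to occur simultaneously, and
   then both barriers would be active, i.e. [l t = u t]. *)
Lemma fixed_point_right_continuous t :
  p s @[s --> t^'+] --> p t /\ m s @[s --> t^'+] --> m t.
Proof.
have pnd := running_max_nd pP; have mnd := running_max_nd mP.
suff H e : 0 < e -> exists2 d, 0 < d & p (t + d) <= p t + e /\ m (t + d) <= m t + e.
  by split; apply: nondecreasing_right_continuous => // e /H[d d0 []]; exists d.
(* If both [p] and [m] were pushed by their barriers on []t, t + d]], adding the bounds [p_or] and
   [m_or] would give [u t - l t <= 2 e1], which the term [(u t - l t) / 4] excludes. *)
move=> e0; pose e1 := Num.min e ((u t - l t) / 4).
have e10 : 0 < e1 by rewrite lt_min e0 divr_gt0 ?subr_gt0.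
have e1e : e1 <= e by rewrite ge_min lexx.
have e1u : e1 <= (u t - l t) / 4 by rewrite ge_min lexx orbT.
have lyc : l s - y s @[s --> t^'+] --> l t - y t by exact: cvgB.
have yuc : y s - u s @[s --> t^'+] --> y t - u t by exact: cvgB.
have [|d1 d10 H1] := @right_continuous_lt _ (fun s => l s - y s) t (l t - y t + e1) lyc.
  by rewrite ltrDl.
have [|d2 d20 H2] := @right_continuous_lt _ (fun s => y s - u s) t (y t - u t + e1) yuc.
  by rewrite ltrDl.
pose d := Num.min d1 d2; have d0 : 0 < d by rewrite lt_min d10.
have dd1 : d <= d1 by rewrite ge_min lexx.
have dd2 : d <= d2 by rewrite ge_min lexx orbT.
exists d => //.
have p_or : p (t + d) <= Num.max (p t) (l t - y t + e1 + m (t + d)).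
  apply/pP; split; first by rewrite le_max (running_max_ge0 pP).
  move=> s std; rewrite le_max; have [st|ts] := leP s t.
    by rewrite (running_max_ge pP st).
  have := H1 s; have := mnd _ _ std; lra.
have m_or : m (t + d) <= Num.max (m t) (y t - u t + e1 + p (t + d)).
  apply/mP; split; first by rewrite le_max (running_max_ge0 mP).
  move=> s std; rewrite le_max; have [st|ts] := leP s t.
    by rewrite (running_max_ge mP st).
  have := H2 s; have := pnd _ _ std; lra.
have := running_max_ge pP (lexx t); have := running_max_ge mP (lexx t).
have : p t <= p (t + d) by apply: pnd; rewrite lerDl ltW.
have : m t <= m (t + d) by apply: mnd; rewrite lerDl ltW.
have := lu t.
by move: p_or m_or; rewrite !le_max => /orP[?|?] /orP[?|?]; split; lra.
Qed.

Lemma fixed_point_sandwich t : l t <= y t + p t - m t <= u t.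
Proof.
have := running_max_ge pP (lexx t); have := running_max_ge mP (lexx t); lra.
Qed.

End fixed_point.

End two_barriers.

(** * Construction of a pair of monotone functions that keeps the path between the barriers *)

Section supersolution.
Context {R : realType}.
Variables (T : R) (y l u : R -> R).

(** Monotonicity and nonnegativity are global and only the sandwich is restricted to [S], so that a
    pair can be prolonged beyond [S]. *)
Definition supersolution (S : set R) (A B : R -> R) :=
  [/\ {homo A : s t / s <= t}, {homo B : s t / s <= t}, forall t, 0 <= A t,
      forall t, 0 <= B t & forall s, S s -> l s <= y s + A s - B s <= u s].

(** Outside [S], both functions are frozen at their values at [tau] plus one jump: the positive part
    of [v - (A tau - B tau)] for [A], the negative part for [B]. Their difference there is exactly
    [v]. *)
Lemma supersolution_extend (S S' : set R) tau v :
  (forall s t, s <= t -> S t -> S s) -> (forall s, S s -> s <= tau) ->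
  (forall s, S' s -> ~ S s -> l s <= y s + v <= u s) ->
  (exists A B, supersolution S A B) -> exists A B, supersolution S' A B.
Proof.
move=> Sdown Stau S'v [A [B [ndA ndB A0 B0 SAB]]].
have ext (C : R -> R) x : {homo C : s t / s <= t} -> (forall t, 0 <= C t) ->
    let D s := if s \in S then C s else C tau + Num.max 0 x in
    {homo D : s t / s <= t} /\ forall t, 0 <= D t.
  move=> ndC C0 D; have x0 : 0 <= Num.max 0 x by rewrite le_max lexx.
  split=> [s t st|t]; rewrite /D; last by case: ifP => _ //; rewrite addr_ge0.
  case: ifPn => sS; case: ifPn => tS //; first exact: ndC.
    apply: le_trans (ndC _ _ (Stau _ (set_mem sS))) _; lra.
  by case/negP: sS; apply/mem_set/(Sdown _ _ st)/set_mem.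
have [ndA' A'0] := ext A (v - (A tau - B tau)) ndA A0.
have [ndB' B'0] := ext B (A tau - B tau - v) ndB B0.
exists (fun s => if s \in S then A s else A tau + Num.max 0 (v - (A tau - B tau))).
exists (fun s => if s \in S then B s else B tau + Num.max 0 (A tau - B tau - v)).
split=> // s S's; case: ifPn => [/set_mem|]; first exact: SAB.
move=> /negP sS; have {sS} nSs : ~ S s by move=> ?; apply/sS/mem_set.
have := S'v _ S's nSs; set b := A tau - B tau => H.
have := erefl b; rewrite {1}/b.
have [|] := leP 0 (v - b); have [|] := leP 0 (b - v); rewrite ?maxEle; lra.
Qed.

Hypotheses (yc : forall t, y s @[s --> t^'+] --> y t)
  (lc : forall t, l s @[s --> t^'+] --> l t)
  (uc : forall t, u s @[s --> t^'+] --> u t).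
Hypothesis lu : forall t, l t < u t.
Hypothesis left_lims : forall t, 0 < t -> exists yt lt ut : R,
  [/\ y s @[s --> t^'-] --> yt, l s @[s --> t^'-] --> lt,
      u s @[s --> t^'-] --> ut & lt < ut].
Hypotheses (y0 : forall s, s <= 0 -> y s = y 0) (l0 : forall s, s <= 0 -> l s = l 0)
  (u0 : forall s, s <= 0 -> u s = u 0).

Lemma supersolution_upto t : 0 <= t ->
  exists A B, supersolution [set s | s <= t] A B.
Proof.
move: t; apply: real_induction.
- apply: (@supersolution_extend set0 _ 0 ((l 0 + u 0) / 2 - y 0)) => //.
    move=> s /= s0 _; rewrite y0// l0// u0//; have := lu 0; lra.
  by exists (cst 0), (cst 0); split=> //.
- move=> s t /andP[s0 st] [A [B [ndA ndB A0 B0 H]]]; exists A, B; split=> // r rs.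
  by apply: H; exact: le_trans rs st.
(* The path [y + v] sits midway between the barriers at [t], hence strictly between them for a short
   time afterwards. *)
- move=> t t0 Pt; pose v := (l t + u t) / 2 - y t.
  have := lu t => lut.
  have [||d1 d10 H1] := @right_continuous_gt _ (fun s => y s + v - l s) t 0.
  - by apply: cvgB => //; apply: cvgD => //; exact: cvg_cst.
  - by rewrite /v; lra.
  have [||d2 d20 H2] := @right_continuous_gt _ (fun s => u s - (y s + v)) t 0.
  - by apply: cvgB => //; apply: cvgD => //; exact: cvg_cst.
  - by rewrite /v; lra.
  exists (Num.min d1 d2); first by rewrite lt_min d10.
  apply: (supersolution_extend (v := v) _ _ _ Pt) => [r s rs st||]; first exact: le_trans st.
  - by move=> s; exact.
  move=> s /=; rewrite -lerBlDl le_min => /andP[sd1 sd2] /negP; rewrite -ltNge => ts.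
  have h1 : t <= s <= t + d1 by lra.
  have h2 : t <= s <= t + d2 by lra.
  move: (H1 s h1) (H2 s h2).
  rewrite !subr_gt0 => /ltW h3 /ltW h4.
  by rewrite h3 h4.
- move=> t t0 Pt; have [yt [lt [ut [yl ll ul ltut]]]] := left_lims t0.
  (* The same centring, now at the left limits: [y + v] fits on an interval []t1, t[], and the pair
     known up to [t1] is extended over it. *)
  pose v := (lt + ut) / 2 - yt.
  have [||d1 d10 H1] := @at_left_gt _ (fun s => y s + v - l s) t (yt + v - lt) 0.
  - by apply: cvgB => //; apply: cvgD => //; exact: cvg_cst.
  - by rewrite /v; lra.
  have [||d2 d20 H2] := @at_left_gt _ (fun s => u s - (y s + v)) t (ut - (yt + v)) 0.
  - by apply: cvgB => //; apply: cvgD => //; exact: cvg_cst.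
  - by rewrite /v; lra.
  pose t1 := Num.max 0 (Num.max (t - d1) (t - d2)).
  have t1t : 0 <= t1 < t by rewrite le_max lexx/= !gt_max; apply/and3P; split; lra.
  have t1d1 : t - d1 <= t1 by rewrite !le_max lexx orbT.
  have t1d2 : t - d2 <= t1 by rewrite !le_max lexx !orbT.
  have : exists A B, supersolution [set s | s < t] A B.
    apply: (supersolution_extend (v := v) _ _ _ (Pt _ t1t)) => [r s rs st||].
    + exact: le_trans st.
    + by move=> s; exact.
    move=> s /= st /negP; rewrite -ltNge => t1s.
    have h1 : t - d1 <= s < t by rewrite st andbT (le_trans t1d1)// ltW.
    have h2 : t - d2 <= s < t by rewrite st andbT (le_trans t1d2)// ltW.
    move: (H1 s h1) (H2 s h2); rewrite !subr_gt0 => /ltW h3 /ltW h4.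
    by rewrite h3 h4.
  (* The paths may jump at [t], so this single time receives a shift of its own. *)
  apply: (@supersolution_extend _ _ t ((l t + u t) / 2 - y t)).
  + by move=> r s /= rs; exact: le_lt_trans.
  + by move=> s /ltW.
  move=> s /= st /negP; rewrite -leNgt => ts; have -> : s = t by apply/le_anti/andP.
  by have := lu t; lra.
Qed.

Hypotheses (yT : forall s, T <= s -> y s = y T) (lT : forall s, T <= s -> l s = l T)
  (uT : forall s, T <= s -> u s = u T).

Lemma supersolution_exists : exists A B, supersolution setT A B.
Proof.
have T0 : 0 <= Num.max 0 T by rewrite le_max lexx.
have [A [B [ndA ndB A0 B0 H]]] := supersolution_upto T0.
(* The paths are constant from this time on, so the last shift remains admissible. *)
apply: (@supersolution_extend [set s | s <= Num.max 0 T] _ (Num.max 0 T)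
   (A (Num.max 0 T) - B (Num.max 0 T))); last by exists A, B.
- by move=> s t st; exact: le_trans.
- by move=> s; exact.
move=> s _ /negP; rewrite -ltNge gt_max => /andP[s0 Ts].
have := H _ (lexx (Num.max 0 T)).
rewrite (yT (ltW Ts)) (lT (ltW Ts)) (uT (ltW Ts)).
have [T0'|/ltW T0'] := leP 0 T; first by rewrite addrA.
by rewrite (yT T0') (lT T0') (uT T0') addrA.
Qed.

End supersolution.

(** * Null sets of Stieltjes measures *)

Section stieltjes.
Context {R : realType}.

(** The set where [g > a] is the union over rational [q] of the sets [D q] of times [t < q] with
    [g > a] on all of [[t, q]]. Each [D q] is an interval, and right-continuity at [t] provides a
    [q]. *)
Lemma right_continuous_measurable (g : R -> R) :
  (forall t, g s @[s --> t^'+] --> g t) -> measurable_fun setT g.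
Proof.
move=> gc; apply: (measurability _ (RGenOInfty.measurableE R)) => //.
move=> _ [_ [a ->] <-]; rewrite setTI.
pose D (q : rat) := [set t | t < ratr q /\ forall s, t <= s <= ratr q -> a < g s].
rewrite (_ : _ @^-1` _ = \bigcup_q D q).
  apply: bigcupT_measurable_rat => q; apply: is_interval_measurable.
  move=> r s [rq Dr] [sq Ds] t /andP[rt ts]; split; first exact: le_lt_trans sq.
  by move=> z /andP[tz zq]; apply: Dr; rewrite zq (le_trans rt).
apply/seteqP; split=> [t /=|t [q _ [tq Dt]] /=]; last first.
  by rewrite in_itv/= andbT; apply: Dt; rewrite lexx ltW.
rewrite in_itv/= andbT => agt; have [d d0 H] := right_continuous_gt (gc t) agt.
have [q /itvP qtd] := rat_in_itvoo (ltr_pwDr d0 (lexx t)).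
exists q => //; split=> [|s /andP[ts sq]]; first by rewrite qtd.
by apply: H; rewrite ts (le_trans sq)// qtd.
Qed.

Variable F : cumulative R R.
Let mu := lebesgue_stieltjes_measure F.

Lemma lebesgue_stieltjes_itv_oc a b : a <= b -> mu `]a, b] = (F b - F a)%:E.
Proof.
move=> ab; rewrite /mu /lebesgue_stieltjes_measure /measure_extension/= measurable_mu_extE/=; last exact: is_ocitv.
by rewrite wlength_itv_bnd.
Qed.

Lemma null_set_flat (N : set R) a b : measurable N -> mu N = 0%E -> a <= b ->
  `]a, b] `<=` N -> F b = F a.
Proof.
move=> mN N0 ab abN; have : mu `]a, b] = 0%E by apply: subset_measure0 N0.
by rewrite lebesgue_stieltjes_itv_oc// => -[/eqP]; rewrite subr_eq0 => /eqP.
Qed.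

(** A jump of at least [e] at [t] would give every []t - 1/(i+1), t]] mass at least [e], hence also
    [[set t]] by continuity from above. *)
Lemma null_set_continuous (N : set R) t e : measurable N -> mu N = 0%E -> N t ->
  0 < e -> exists2 s, s < t & F t - e < F s.
Proof.
move=> mN N0 Nt e0; apply: contrapT => H.
have {}H s : s < t -> F s <= F t - e.
  by move=> st; rewrite leNgt; apply/negP => ?; apply: H; exists s.
have mut0 : mu [set t] = 0%E by apply: subset_measure0 N0 => // _ ->.
have : (e%:E <= mu [set t])%E; last by rewrite mut0 lee_fin leNgt e0.
rewrite set1_bigcap_oc; pose J i := `]t - i.+1%:R^-1, t]%classic.
have low i : (e%:E <= mu (J i))%E.
  have ti : t - i.+1%:R^-1 < t by rewrite ltrBlDr ltrDl invr_gt0.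
  by rewrite /J lebesgue_stieltjes_itv_oc ?(ltW ti)// lee_fin; have := H _ ti; lra.
have cvgmu : mu (J i) @[i --> \oo] --> mu (\bigcap_i J i).
  apply: nonincreasing_cvg_mu => //.
  - have : (mu (J 0%N) < +oo)%E by rewrite /J lebesgue_stieltjes_itv_oc ?ltry// gerBl invr_ge0.
    exact.
  - by move=> n; exact: measurable_itv.
  - by apply: bigcapT_measurable => n; exact: measurable_itv.
  - move=> m n mn; apply/subsetPset => s; rewrite /J /= !in_itv/= => /andP[ms ->].
    rewrite andbT; apply: le_lt_trans ms; rewrite lerD2l lerN2.
    by rewrite lef_pV2 ?posrE// ler_nat.
rewrite -(cvg_lim _ cvgmu)//; apply: lime_ge; first by apply: cvgP cvgmu.
exact: nearW.
Qed.

(* For rational [q], the [t < q] with [F t- = F t = F q] lie in the closed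
   interval from their infimum [m] to [q], and [F] is constant on [m, q]. *)
Lemma flat_right_null (N : set R) : measurable N -> has_lbound N ->
  (forall t, N t -> (exists2 d, 0 < d & F (t + d) = F t) /\
    forall e, 0 < e -> exists2 s, s < t & F t - e < F s) ->
  mu N = 0%E.
Proof.
move=> mN [b bN] NF; have ndF := cumulative_is_nondecreasing F.
have mu1 t : N t -> mu [set t] = 0%E.
  move=> /NF[_ Ft]; apply/eqP; rewrite eq_le measure_ge0 andbT.
  apply/lee_addgt0Pr => e e0; rewrite add0e.
  have [s st Fs] := Ft e e0.
  apply: (@le_trans _ _ (mu `]s, t])); last first.
    by rewrite lebesgue_stieltjes_itv_oc ?(ltW st)// lee_fin; lra.
  by apply: le_measure; rewrite ?inE// => _ ->; rewrite /= in_itv/= st lexx.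
pose D (q : rat) := [set t | N t /\ t < ratr q /\ F t = F (ratr q)].
have negD q : mu.-negligible (D q).
  have [[t0 Dt0]|D0] := pselect (D q !=set0); last first.
    apply: (negligibleS _ (@negligible_set0 _ _ _ mu)) => t Dt.
    by case: D0; exists t.
  have lbD : has_lbound (D q) by exists b => t [Nt _]; exact: bN.
  pose m := inf (D q).
  have mD t : D q t -> m <= t by move=> Dt; exact: ge_inf.
  have mq : m < ratr q by apply: le_lt_trans (mD _ Dt0) _; have [_ []] := Dt0.
  have Fm : F m = F (ratr q).
    apply/le_anti/andP; split; first by apply: ndF; exact: ltW.
    apply/ler_addgt0Pr => e e0; have [d Fd] := nondecreasing_right_continuousP m F e0.
    have [t [Nt [tq Ftq]] tmd] := inf_lt (ex_intro _ t0 Dt0) (ltr_pwDr [gt0 of d%:num] (lexx m)).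
    by rewrite -Ftq; apply: le_trans Fd; apply: ndF; exact: ltW.
  have mumq : mu `]m, ratr q] = 0%E by rewrite lebesgue_stieltjes_itv_oc ?ltW// Fm subrr.
  have negmq : mu.-negligible `]m, ratr q] by apply/negligibleP.
  (* If the infimum is attained, the half-open interval misses it, and the absence of a jump there
     makes [[set m]] null. *)
  have [Dm|nDm] := pselect (D q m).
    have negm : mu.-negligible [set m] by apply/negligibleP => //; apply: mu1; case: Dm.
    apply: negligibleS (negligibleU negm negmq) => t Dt.
    have := mD _ Dt; rewrite le_eqVlt => /predU1P[->|mt]; first by left.
    by right; rewrite /= in_itv/= mt ltW//; have [_ []] := Dt.
  apply: negligibleS negmq => t Dt; rewrite /= in_itv/=.
  have [_ [/ltW -> _]] := Dt; rewrite andbT lt_neqAle mD// andbT.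
  by apply/eqP => mt; apply: nDm; rewrite mt.
apply/negligibleP => //.
pose G n := if @unpickle rat n is Some q then D q else set0.
have negG n : mu.-negligible (G n).
  by rewrite /G; case: unpickle => // ; exact: negligible_set0.
apply: negligibleS (negligible_bigcup negG) => t Nt.
have [[d d0 Ftd] _] := NF _ Nt.
have [q /itvP qtd] := rat_in_itvoo (ltr_pwDr d0 (lexx t)).
have GE : G (pickle q) = D q by rewrite /G pickleK.
exists (pickle q); [exact: I|rewrite GE].
split=> //; split; first by rewrite qtd.
apply/le_anti/andP; split; first by apply: ndF; rewrite ltW// qtd.
by rewrite -Ftd; apply: ndF; rewrite ltW// qtd.
Qed.

Lemma measurable_positivity_set T (g : R -> R) : measurable_fun setT g ->
  measurable [set t | 0 <= t <= T /\ 0 < g t].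
Proof.
move=> mg; rewrite (_ : [set t | _] = `[0, T] `&` g @^-1` `]0, +oo[).
  by apply: measurable_funTS.
by apply/seteqP; split=> t /=; rewrite !in_itv/= andbT.
Qed.

Lemma stieltjes0P T (g : R -> R) :
  measurable_fun setT g -> (forall t, 0 <= t <= T -> 0 <= g t) ->
  (\int[mu]_(s in `[0%R, T]) (g s)%:E = 0)%E <->
  mu [set t | 0 <= t <= T /\ 0 < g t] = 0%E.
Proof.
move=> mg g0.
have mg' : measurable_fun `[0, T] (EFin \o g).
  by apply/measurable_EFinP; exact: measurable_funTS.
have -> : (\int[mu]_(s in `[0%R, T]) (g s)%:E = \int[mu]_(s in `[0%R, T]) `|(EFin \o g) s|)%E.
  apply: eq_integral => s; rewrite inE/= in_itv/= => sT.
  by rewrite ger0_norm// g0.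
have mD := measurable_positivity_set T mg.
rewrite ae_eq_integral_abs//; split.
  move=> H; apply/negligibleP => //; apply: negligibleS H => t /= [tT gt0] H.
  by have := H _; rewrite /= in_itv/= tT => /(_ isT)[] gt00; rewrite gt00 ltxx in gt0.
move=> /negligibleP => /(_ mD); apply: negligibleS => t /= /not_implyP[].
rewrite in_itv/= => tT gt0; split=> //; rewrite lt_neqAle g0// andbT eq_sym.
by apply/eqP => gt00; apply: gt0; rewrite gt00.
Qed.

End stieltjes.

(** * Pathwise Skorokhod problem *)

Section uniqueness.
Context {R : realType}.
Variable T : R.
Implicit Types (f g k x y l u p m : R -> R).

(** The retraction onto [[0, T]] that [is_stieltjes_integral] applies to the integrator; composing
    with it turns conditions on [[0, T]] into conditions at all real times. *)
Definition clamp t : R := Num.max 0 (Num.min t T).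

Definition right_continuous_clamp f :=
  forall t, f (clamp s) @[s --> t^'+] --> f (clamp t).

Lemma clamp_id t : 0 <= t <= T -> clamp t = t.
Proof. by move=> /andP[t0 tT]; rewrite /clamp min_l// max_r. Qed.

Lemma rcll_right_continuous_clamp f : 0 < T -> rcll_path T f ->
  right_continuous_clamp f.
Proof.
move=> T0 [fc _] t.
have [t0|t0] := ltP t 0.
  rewrite (_ : f (clamp t) = f 0); last by rewrite /clamp max_l// ge_min ltW.
  apply: cvg_near_cst; near=> s; rewrite /clamp max_l// ge_min; apply/orP; left.
  by near: s; apply: nbhs_right_le.
have [tT|Tt] := ltP t T; last first.
  rewrite (_ : clamp t = T); last by rewrite /clamp min_r// max_r// ltW.
  apply: cvg_near_cst; near=> s; rewrite /clamp min_r ?max_r// 1?ltW//.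
  apply: (le_lt_trans Tt); near: s; exact: nbhs_right_gt.
rewrite clamp_id ?t0 ?ltW//; have : f s @[s --> t^'+] --> f t by apply: fc; rewrite t0.
apply: cvg_trans; apply: near_eq_cvg; near=> s; rewrite clamp_id//.
apply/andP; split; first by apply: (le_trans t0); near: s; exact: nbhs_right_ge.
by near: s; exact: nbhs_right_le.
Unshelve. all: by end_near. Qed.

(** The two pathwise consequences of a vanishing integral of [g] against [dk]: no growth over
    stretches where [g > 0], and no jump at a time where [g > 0]. *)
Definition flat_where g k :=
  (forall a b, 0 <= a -> a <= b -> b <= T ->
    (forall s, a < s <= b -> 0 < g s) -> k b = k a) /\
  (forall t e, 0 < t <= T -> 0 < g t -> 0 < e ->
    exists2 s, 0 <= s < t & k t - e < k s).

Lemma right_continuous_clamp_gt g t : right_continuous_clamp g ->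
  0 <= t <= T -> 0 < g t ->
  exists2 d, 0 < d & forall s, t <= s <= t + d -> s <= T -> 0 < g s.
Proof.
move=> gc tT gt0; have [|d d0 H] := @right_continuous_gt _ (g \o clamp) t 0 (gc t).
  by rewrite /= clamp_id.
exists d => // s std sT; have := H s std; rewrite /= clamp_id// sT andbT.
by move: tT std => /andP[t0 _] /andP[ts _]; exact: le_trans ts.
Qed.

(** The set where [g > 0] is null for the Stieltjes measure, so it can contain neither an interval
    of growth nor a jump. *)
Lemma stieltjes0_flat g k : right_continuous_clamp g ->
  (forall t, 0 <= t <= T -> 0 <= g t) ->
  is_stieltjes_integral T g k 0%E -> flat_where g k.
Proof.
move=> gc g0 [F [Fk gF]].
have mg : measurable_fun setT (g \o clamp) by exact: right_continuous_measurable.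
have gc0 t : 0 <= t <= T -> 0 <= (g \o clamp) t by move=> tT; rewrite /= clamp_id// g0.
have mN := measurable_positivity_set T mg.
have N0 : lebesgue_stieltjes_measure F [set t | 0 <= t <= T /\ 0 < (g \o clamp) t] = 0%E.
  apply/stieltjes0P => //; rewrite -gF; apply: eq_integral => s.
  by rewrite inE/= in_itv/= => sT; rewrite clamp_id.
have FkT t : 0 <= t <= T -> F t = k t by move=> tT; rewrite Fk -/(clamp t) clamp_id.
split=> [a b a0 ab bT gab|t e /andP[t0 tT] gt0 e0].
  rewrite -!FkT ?a0 ?bT ?(le_trans a0) ?(le_trans ab)//.
  apply: (null_set_flat mN N0 ab) => s /=; rewrite in_itv/= => /andP[sa sb].
  have sT : 0 <= s <= T by rewrite (le_trans a0 (ltW sa)) (le_trans sb).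
  by rewrite clamp_id//; split=> //; apply: gab; rewrite sa.
have tT' : 0 <= t <= T by rewrite ltW.
have [|s st Fs] := null_set_continuous (t := t) mN N0 _ e0.
  by split=> //=; rewrite clamp_id.
(* The time [s] may be negative; moving it to 0 keeps it before [t] and can only increase [F]. *)
exists (Num.max 0 s); first by rewrite le_max lexx gt_max t0.
have st' : 0 <= Num.max 0 s <= T.
  by rewrite le_max lexx/= ge_max (le_trans (ltW t0) tT) (le_trans (ltW st) tT).
rewrite -!FkT//; apply: (lt_le_trans Fs).
by apply: cumulative_is_nondecreasing; rewrite le_max lexx orbT.
Qed.

(* After the last time before [t] at which [x <= x'], neither [p] nor [m'] can
   grow, so [x - x'] can only decrease. *)
Lemma reflected_le x x' l u p m p' m' :
  (forall t, 0 <= t <= T -> x t - x' t = p t - m t - p' t + m' t) ->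
  x 0 <= x' 0 ->
  increasing_from0 T p -> increasing_from0 T m ->
  increasing_from0 T p' -> increasing_from0 T m' ->
  (forall t, 0 <= t <= T -> l t <= x' t) -> (forall t, 0 <= t <= T -> x t <= u t) ->
  flat_where (fun s => x s - l s) p -> flat_where (fun s => u s - x' s) m' ->
  forall t, 0 <= t <= T -> x t <= x' t.
Proof.
move=> xx' x0 [_ _ pnd] [_ _ mnd] [_ _ p'nd] [_ _ m'nd] lx' xu [pf pl] [m'f m'l].
move=> t /andP[t0 tT]; rewrite leNgt; apply/negP => x't.
pose A := [set s | 0 <= s <= t /\ x s <= x' s].
have A0 : A 0 by split=> //; rewrite lexx.
have ubA : has_ubound A by exists t => s [/andP[]].
pose c := sup A.
have c0 : 0 <= c by apply: ub_le_sup.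
have ct : c <= t by apply: ge_sup; [exists 0|move=> s [/andP[]]].
have gtc s : c < s -> s <= t -> x' s < x s.
  move=> cs st; rewrite ltNge; apply/negP => xs.
  have : s <= c by apply: ub_le_sup => //; split=> //; rewrite st (le_trans c0)// ltW.
  by rewrite leNgt cs.
have inT s : 0 <= s -> s <= t -> 0 <= s <= T by move=> -> st; rewrite (le_trans st).
have pc : p t = p c.
  apply: pf => // s /andP[cs st]; rewrite subr_gt0.
  by apply: le_lt_trans (gtc s cs st); apply: lx'; apply: inT => //; rewrite (le_trans c0)// ltW.
have m'c : m' t = m' c.
  apply: m'f => // s /andP[cs st]; rewrite subr_gt0.
  by apply: lt_le_trans (gtc s cs st) _; apply: xu; apply: inT => //; rewrite (le_trans c0)// ltW.
(* Over []c, t]] only [m] and [p'] can grow, and both lower [x - x']; the gap at [c] is thus at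
   least the gap at [t]. *)
have x'c : x' c < x c.
  have := xx' t (inT _ t0 (lexx t)); have := xx' c (inT _ c0 ct).
  by have := mnd c t c0 ct tT; have := p'nd c t c0 ct tT; lra.
have c_gt0 : 0 < c.
  by rewrite lt_neqAle c0 andbT; apply/eqP => ce; move: x'c; rewrite -ce ltNge x0.
have cT : 0 < c <= T by rewrite c_gt0 (le_trans ct).
(* Just before [c], each of [p] and [m'] is within half the gap of its value at [c]. At a point of
   [A] that close to [c] this still gives [x > x'], a contradiction. *)
have e0 : 0 < (x c - x' c) / 2 by rewrite divr_gt0// subr_gt0.
have lxc : 0 < x c - l c by rewrite subr_gt0; apply: le_lt_trans x'c; apply: lx'; exact: inT.
have uxc : 0 < u c - x' c by rewrite subr_gt0; apply: lt_le_trans x'c _; apply: xu; exact: inT.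
have [s1 /andP[s10 s1c] Hs1] := pl _ _ cT lxc e0.
have [s2 /andP[s20 s2c] Hs2] := m'l _ _ cT uxc e0.
have [||s [/andP[s0 st] xs] s12] := @sup_gt _ A (Num.max s1 s2).
- by exists 0.
- by rewrite gt_max s1c.
have sc : s <= c by apply: ub_le_sup => //; split=> //; rewrite s0.
move: s12; rewrite gt_max => /andP[s1s s2s].
have sT : s <= T by apply: le_trans tT.
have := pnd _ _ s10 (ltW s1s) sT; have := m'nd _ _ s20 (ltW s2s) sT.
have := mnd _ _ s0 sc (le_trans ct tT); have := p'nd _ _ s0 sc (le_trans ct tT).
by have := xx' s (inT _ s0 st); have := xx' c (inT _ c0 ct); lra.
Qed.

(* At each time one of the two barriers is inactive, hence so are the
   corresponding regulators, and the other two have the same increments. *)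
Lemma reflected_regulator_eq x l u p m p' m' :
  (forall t, 0 <= t <= T -> p t - m t = p' t - m' t) ->
  (forall t, 0 <= t <= T -> l t < u t) ->
  right_continuous_clamp (fun s => x s - l s) ->
  right_continuous_clamp (fun s => u s - x s) ->
  increasing_from0 T p -> increasing_from0 T m ->
  increasing_from0 T p' -> increasing_from0 T m' ->
  (forall t, 0 <= t <= T -> l t <= x t) ->
  flat_where (fun s => x s - l s) p -> flat_where (fun s => x s - l s) p' ->
  flat_where (fun s => u s - x s) m -> flat_where (fun s => u s - x s) m' ->
  forall t, 0 <= t <= T -> p t = p' t.
Proof.
move=> pm lu xlc uxc [p0 _ pnd] [m0 _ mnd] [p'0 _ p'nd] [m'0 _ m'nd] lx.
move=> [pf pl] [p'f p'l] [mf ml] [m'f m'l].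
(* Real induction runs over the whole half-line, so the cap [s <= T] is put inside the predicate. *)
suff H t : 0 <= t -> forall s, 0 <= s <= t -> s <= T -> p s = p' s.
  by move=> t /andP[t0 tT]; apply: (H t t0) => //; rewrite t0 lexx.
move: t; apply: real_induction.
- move=> s s0 _; have -> : s = 0 by apply/le_anti; rewrite andbC.
  by rewrite p0.
- move=> s t /andP[s0 st] H r /andP[r0 rs] rT.
  by apply: H => //; rewrite r0 (le_trans rs st).
- move=> t t0 H; have [tT|Tt] := leP t T; last first.
    exists 1 => // s /andP[s0 _] sT; apply: H => //; rewrite s0 (le_trans sT)//.
    exact: ltW.
  have tT' : 0 <= t <= T by rewrite t0.
  have := lx t tT'; rewrite le_eqVlt => /predU1P[xl|xl].
    have [|d d0 Hd] := right_continuous_clamp_gt uxc tT'.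
      by rewrite subr_gt0 -xl lu.
    exists d => // s /andP[s0 sd] sT; have [st|/ltW ts] := leP s t.
      by apply: H => //; rewrite s0.
    have gs r : t < r <= s -> 0 < u r - x r.
      move=> /andP[tr rs]; apply: Hd; last exact: le_trans rs sT.
      by rewrite (ltW tr) (le_trans rs).
    have := mf t s t0 ts sT gs; have := m'f t s t0 ts sT gs.
    have := pm s; rewrite s0 sT => /(_ isT); have := pm t tT'.
    by have := H t; rewrite t0 lexx => /(_ isT tT); lra.
  have [|d d0 Hd] := right_continuous_clamp_gt xlc tT'.
    by rewrite subr_gt0.
  exists d => // s /andP[s0 sd] sT; have [st|/ltW ts] := leP s t.
    by apply: H => //; rewrite s0.
  have gs r : t < r <= s -> 0 < x r - l r.
    move=> /andP[tr rs]; apply: Hd; last exact: le_trans rs sT.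
    by rewrite (ltW tr) (le_trans rs).
  rewrite (pf t s t0 ts sT gs) (p'f t s t0 ts sT gs).
  by apply: H => //; rewrite t0 lexx.
- move=> t t0 H s /andP[s0]; rewrite le_eqVlt => /predU1P[->|st] sT; last first.
    by apply: (H s) => //; rewrite s0// lexx.
  have tT' : 0 < t <= T by rewrite t0.
  have tT'' : 0 <= t <= T by rewrite (ltW t0).
  have {}H r : 0 <= r -> r < t -> p r = p' r.
    move=> r0 rt; apply: (H r); rewrite ?r0 ?rt ?lexx//.
    by rewrite (le_trans (ltW rt)).
  have := lx t tT''; rewrite le_eqVlt => /predU1P[xl|xl].
    have ux : 0 < u t - x t by rewrite subr_gt0 -xl lu.
    suff mm' : m t = m' t by have := pm t tT''; lra.
    have mm' r : 0 <= r -> r < t -> m r = m' r.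
      move=> r0 rt; have := H r r0 rt; have := pm r.
      by rewrite r0 (le_trans (ltW rt) sT) => /(_ isT); lra.
    (* Without a jump at [t], some earlier [r] gives [m t < m r + e = m' r + e <= m' t + e], and
       symmetrically. *)
    apply/le_anti/andP; split; apply/ler_addgt0Pr => e e0.
      have [r /andP[r0 rt] Hr] := ml t e tT' ux e0.
      by have := m'nd r t r0 (ltW rt) sT; rewrite -mm'//; lra.
    have [r /andP[r0 rt] Hr] := m'l t e tT' ux e0.
    by have := mnd r t r0 (ltW rt) sT; rewrite mm'//; lra.
  have lx' : 0 < x t - l t by rewrite subr_gt0.
  apply/le_anti/andP; split; apply/ler_addgt0Pr => e e0.
    have [r /andP[r0 rt] Hr] := pl t e tT' lx' e0.
    by have := p'nd r t r0 (ltW rt) sT; rewrite -H//; lra.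
  have [r /andP[r0 rt] Hr] := p'l t e tT' lx' e0.
  by have := pnd r t r0 (ltW rt) sT; rewrite H//; lra.
Qed.

End uniqueness.

(** * Uniqueness and existence for a single path *)

Section path_solutions.
Context {R : realType}.
Variable T : R.
Hypothesis T_gt0 : 0 < T.
Implicit Types (f g k x y l u p m : R -> R).

Definition path_solution y l u x p m :=
  [/\ increasing_from0 T p /\ increasing_from0 T m,
      forall t, 0 <= t <= T -> x t = y t + p t - m t,
      forall t, 0 <= t <= T -> l t <= x t <= u t,
      is_stieltjes_integral T (fun s => x s - l s) p 0%E &
      is_stieltjes_integral T (fun s => u s - x s) m 0%E].

Lemma clamp_itv t : 0 <= clamp T t <= T.
Proof. by rewrite /clamp le_max lexx/= ge_max ge_min lexx orbT andbT ltW. Qed.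

Lemma clamp_nd : {homo clamp T : s t / s <= t}.
Proof.
move=> s t st; rewrite /clamp ge_max !le_max lexx/=.
by rewrite le_min !ge_min st lexx !orbT.
Qed.

(** Right-continuity of the regulators is not a clause of [path_solution]; it comes from the
    integrator whose existence the integral asserts. *)
Lemma stieltjes_right_continuous_clamp g k v :
  is_stieltjes_integral T g k v -> right_continuous_clamp T k.
Proof.
move=> [F [Fk _]] t; have := cumulative_is_right_continuous F t.
by rewrite Fk (_ : F = k \o clamp T :> (R -> R))//; apply/funext => s; rewrite Fk.
Qed.

Lemma path_solution_right_continuous_clamp y l u x p m :
  rcll_path T y -> rcll_path T l -> rcll_path T u -> path_solution y l u x p m ->
  right_continuous_clamp T (fun s => x s - l s) /\
  right_continuous_clamp T (fun s => u s - x s).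
Proof.
move=> /(rcll_right_continuous_clamp T_gt0) yc /(rcll_right_continuous_clamp T_gt0) lc.
move=> /(rcll_right_continuous_clamp T_gt0) uc [_ xE _ sp sm].
have pc := stieltjes_right_continuous_clamp sp.
have mc := stieltjes_right_continuous_clamp sm.
have xc : right_continuous_clamp T x.
  move=> t; rewrite (_ : (fun s => _) = fun s => y (clamp T s) + p (clamp T s) - m (clamp T s)).
    by rewrite xE ?clamp_itv//; apply: cvgB => //; apply: cvgD.
  by apply/funext => s; rewrite xE ?clamp_itv.
by split=> t; apply: cvgB.
Qed.

Lemma path_solution_flat y l u x p m :
  rcll_path T y -> rcll_path T l -> rcll_path T u -> path_solution y l u x p m ->
  flat_where T (fun s => x s - l s) p /\ flat_where T (fun s => u s - x s) m.
Proof.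
move=> yc lc uc sol; have [xlc uxc] := path_solution_right_continuous_clamp yc lc uc sol.
have [_ _ lxu sp sm] := sol.
by split; apply: stieltjes0_flat => // t /lxu/andP[? ?]; rewrite subr_ge0.
Qed.

Lemma path_solution_unique y l u x p m x' p' m' :
  rcll_path T y -> rcll_path T l -> rcll_path T u ->
  (forall t, 0 <= t <= T -> l t < u t) ->
  path_solution y l u x p m -> path_solution y l u x' p' m' ->
  forall t, 0 <= t <= T -> [/\ x t = x' t, p t = p' t & m t = m' t].
Proof.
move=> yc lc uc lu sol sol'.
have [pf mf] := path_solution_flat yc lc uc sol.
have [p'f m'f] := path_solution_flat yc lc uc sol'.
have [xlc uxc] := path_solution_right_continuous_clamp yc lc uc sol.
have [[pi mi] xE lxu _ _] := sol; have [[p'i m'i] x'E lx'u _ _] := sol'.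
have T00 : 0 <= (0 : R) <= T by rewrite lexx ltW.
have x0 : x 0 = x' 0.
  by rewrite xE// x'E//; case: pi mi p'i m'i => -> _ _ [-> _ _] [-> _ _] [-> _ _].
have xx' t : 0 <= t <= T -> x t = x' t.
  (* The comparison is applied twice, with the two solutions exchanged. *)
  move=> tT; apply/le_anti/andP; split; move: t tT.
    apply: (reflected_le (l := l) (u := u) _ _ pi mi p'i m'i) => //.
    - by move=> t tT; rewrite xE// x'E//; lra.
    - by rewrite x0.
    - by move=> t /lx'u/andP[].
    - by move=> t /lxu/andP[].
  apply: (reflected_le (l := l) (u := u) _ _ p'i m'i pi mi) => //.
  - by move=> t tT; rewrite xE// x'E//; lra.
  - by rewrite x0.
  - by move=> t /lxu/andP[].
  - by move=> t /lx'u/andP[].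
have eqflat g g' k : (forall t, 0 <= t <= T -> g t = g' t) ->
    flat_where T g k -> flat_where T g' k.
  move=> gg' [H1 H2]; split=> [a b a0 ab bT H|t e tT gt0].
    apply: H1 => // s /andP[sa sb]; rewrite gg' ?H ?sa//.
    by rewrite (le_trans sb) // (le_trans a0)// ltW.
  by apply: H2 => //; rewrite gg'//; case/andP: tT => /ltW -> ->.
have {}p'f : flat_where T (fun s => x s - l s) p'.
  by apply: eqflat p'f => t tT; rewrite xx'.
have {}m'f : flat_where T (fun s => u s - x s) m'.
  by apply: eqflat m'f => t tT; rewrite xx'.
have pp' := reflected_regulator_eq (l := l) (u := u) (x := x) (p := p) (m := m)
  (p' := p') (m' := m').
move=> t tT; have pt : p t = p' t.
  move: t tT; apply: pp' => //.
  - by move=> t tT; have := xx' t tT; rewrite xE// x'E//; lra.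
  - by move=> t /lxu/andP[].
split; [exact: xx'|exact: pt|].
by have := xx' t tT; rewrite xE// x'E// pt; lra.
Qed.

Lemma nondecreasing_rcll k : {homo k : s t / s <= t} ->
  (forall t, k s @[s --> t^'+] --> k t) -> rcll_path T k.
Proof.
move=> ndk kc; split=> [t _|t _]; first exact: kc.
apply/cvg_ex/nondecreasing_at_left_is_cvgr; near=> s.
  by move=> a b _ _; exact: ndk.
by exists (k t) => _ /= [r /itvP rt <-]; apply: ndk; rewrite rt.
Unshelve. all: by end_near. Qed.

(** The converse direction to [stieltjes0_flat]: local flatness to the right and absence of jumps
    make the set where [g > 0] null, by [flat_right_null]. *)
Lemma flat_stieltjes0 g k : {homo k : s t / s <= t} ->
  right_continuous_clamp T k -> right_continuous_clamp T g ->
  (forall t, 0 <= t <= T -> 0 <= g t) ->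
  (forall t, 0 <= t <= T -> 0 < g t -> (exists2 d, 0 < d & k (t + d) = k t) /\
    forall e, 0 < e -> exists2 s, s < t & k t - e < k s) ->
  is_stieltjes_integral T g (k \o clamp T) 0%E.
Proof.
move=> ndk kc gc g0 flat.
have ndF : {homo k \o clamp T : s t / s <= t} by move=> s t st; exact/ndk/clamp_nd.
pose F : cumulative R R :=
  HB.pack_for (cumulative R R) (k \o clamp T) (isCumulative.Build R _ R (k \o clamp T) ndF kc).
exists F; split.
  by move=> t; rewrite /F/= -/(clamp T t) (clamp_id (clamp_itv t)).
have mg : measurable_fun setT (g \o clamp T) by exact: right_continuous_measurable.
rewrite (_ : (\int[_]_(s in _) _)%E =
    (\int[lebesgue_stieltjes_measure F]_(s in `[0%R, T]) ((g \o clamp T) s)%:E)%E); last first.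
  by apply: eq_integral => s; rewrite inE/= in_itv/= => sT; rewrite clamp_id.
apply/stieltjes0P => //; first by move=> t tT; rewrite /= g0// clamp_itv.
apply: flat_right_null; first exact: measurable_positivity_set.
  by exists 0 => t [/andP[]].
move=> t [tT]; rewrite /= clamp_id// => gt0; have [[d d0 ktd] kl] := flat t tT gt0.
have /andP[t0 tT'] := tT; split.
  exists d => //; apply/le_anti/andP; split.
    rewrite -ktd; apply: ndk; rewrite /clamp ge_max ge_min lexx/= andbT.
    by rewrite addr_ge0// ltW.
  by rewrite -[in leLHS](clamp_id tT); apply/ndk/clamp_nd; rewrite lerDl ltW.
move=> e /kl[s st ks]; exists s => //; apply: (lt_le_trans ks); apply: ndk.
by rewrite /clamp le_max le_min lexx (le_trans (ltW st) tT') orbT.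
Qed.

(** * Existence from the fixed point of the clamped paths *)

Section existence.
Variables (y l u : R -> R).
Hypotheses (y_rcll : rcll_path T y) (l_rcll : rcll_path T l) (u_rcll : rcll_path T u).
Hypothesis lu : forall t, 0 <= t <= T -> l t < u t.
Hypothesis left_lu : forall t, 0 < t <= T -> left_limit l t < left_limit u t.
Hypothesis lyu0 : l 0 <= y 0 <= u 0.

Let yc := rcll_right_continuous_clamp T_gt0 y_rcll.
Let lc := rcll_right_continuous_clamp T_gt0 l_rcll.
Let uc := rcll_right_continuous_clamp T_gt0 u_rcll.

Definition plus_path := plus_reg (y \o clamp T) (l \o clamp T) (u \o clamp T).
Definition minus_path := minus_reg (y \o clamp T) (l \o clamp T) (u \o clamp T).

Let clamp_le0 t : t <= 0 -> clamp T t = clamp T 0.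
Proof. by move=> t0; rewrite /clamp !max_l// ge_min ?lexx// t0. Qed.

Let clamp_geT t : T <= t -> clamp T t = clamp T T.
Proof. by move=> Tt; rewrite /clamp !min_r. Qed.

Let clamp_left f t : rcll_path T f -> 0 < t <= T ->
  f (clamp T s) @[s --> t^'-] --> left_limit f t.
Proof.
move=> [_ fl] /[dup] t0T /andP[t0 tT]; rewrite /left_limit t0.
have : cvg (f s @[s --> t^'-]) by apply/cvg_ex; exact: fl.
apply: cvg_trans; apply: near_eq_cvg; near=> s; rewrite clamp_id//; apply/andP; split.
  by near: s; exact: nbhs_left_ge.
by apply: le_trans tT; near: s; exact: nbhs_left_le.
Unshelve. all: by end_near. Qed.

Lemma clamped_supersolution :
  exists A B, supersolution (y \o clamp T) (l \o clamp T) (u \o clamp T) setT A B.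
Proof.
apply: (@supersolution_exists _ T).
- exact: yc.
- exact: lc.
- exact: uc.
- by move=> t; apply: lu; exact: clamp_itv.
- move=> t t0; have [tT|Tt] := leP t T.
    exists (left_limit y t), (left_limit l t), (left_limit u t).
    by split; [apply: clamp_left..|apply: left_lu]; rewrite ?t0.
  (* Past [T] the clamped paths are constant, so their left limits are the values at [T], ordered by
     [lu]. *)
  exists (y T), (l T), (u T); split; last by apply: lu; rewrite lexx ltW.
  1-3: by apply: cvg_near_cst; near=> s; rewrite /= clamp_geT ?clamp_id ?lexx ?ltW//;
    near: s; exact: nbhs_left_gt.
- by move=> s s0; rewrite /= clamp_le0.
- by move=> s s0; rewrite /= clamp_le0.
- by move=> s s0; rewrite /= clamp_le0.
- by move=> s s0; rewrite /= clamp_geT.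
- by move=> s s0; rewrite /= clamp_geT.
- by move=> s s0; rewrite /= clamp_geT.
Unshelve. all: by end_near. Qed.

Let plusP : is_running_max (fun s => (l \o clamp T) s - (y \o clamp T) s + minus_path s) plus_path.
Proof.
have [A [B [ndA ndB A0 B0 AB]]] := clamped_supersolution.
by apply: (plus_regP ndA ndB A0 B0) => t; exact: AB.
Qed.

Let minusP : is_running_max (fun s => (y \o clamp T) s - (u \o clamp T) s + plus_path s) minus_path.
Proof.
have [A [B [ndA ndB A0 B0 AB]]] := clamped_supersolution.
by apply: (minus_regP ndA ndB A0 B0) => t; exact: AB.
Qed.

Let rc t : plus_path s @[s --> t^'+] --> plus_path t /\
  minus_path s @[s --> t^'+] --> minus_path t.
Proof.
apply: fixed_point_right_continuous plusP minusP t; [exact: yc|exact: lc|exact: uc|].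
by move=> t; apply: lu; exact: clamp_itv.
Qed.

(** The running maxima also look at negative times, where the clamped paths keep their values at 0.
    There [l 0 <= y 0 <= u 0] keeps every input nonpositive, by induction on the iterates. *)
Let path_at0 : plus_path 0 <= 0 /\ minus_path 0 <= 0.
Proof.
have [A [B [ndA ndB A0 B0 AB]]] := clamped_supersolution.
have {}AB t : (l \o clamp T) t <= (y \o clamp T) t + A t - B t <= (u \o clamp T) t by exact: AB.
have c0 : clamp T 0 = 0 by rewrite clamp_id// lexx ltW.
have /andP[ly yu] := lyu0.
pose mi n s := minus_iter (y \o clamp T) (l \o clamp T) (u \o clamp T) n s.
pose pi n s := plus_iter (y \o clamp T) (l \o clamp T) (u \o clamp T) n s.
have pi0 n : (forall s, s <= 0 -> mi n s <= 0) -> forall s, s <= 0 -> pi n s <= 0.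
  move=> H s s0; apply/(plus_iterP ndA ndB A0 B0 AB); split=> // r rs.
  have r0 := le_trans rs s0.
  by have := H r r0; rewrite /mi /= clamp_le0// c0; lra.
have mi0 n : forall s, s <= 0 -> mi n s <= 0.
  elim: n => [|n /pi0 IHn] s s0 //.
  apply/(minus_iterSP ndA ndB A0 B0 AB); split=> // r rs.
  have r0 := le_trans rs s0.
  by have := IHn r r0; rewrite /pi /= clamp_le0// c0; lra.
split.
  by apply/(plus_reg_le ndA ndB A0 B0 AB) => n; apply: pi0 => //; exact: mi0.
by apply/(minus_reg_le ndA ndB A0 B0 AB) => n; exact: mi0.
Qed.

Lemma path_rcll : rcll_path T (plus_path \o clamp T) /\ rcll_path T (minus_path \o clamp T).
Proof.
have pnd := running_max_nd plusP; have mnd := running_max_nd minusP.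
have R1 (k : R -> R) : {homo k : s t / s <= t} -> (forall t, k s @[s --> t^'+] --> k t) ->
    rcll_path T (k \o clamp T).
  move=> knd kc; have kr := rcll_right_continuous_clamp T_gt0 (nondecreasing_rcll knd kc).
  by apply: nondecreasing_rcll => // s t st; exact/knd/clamp_nd.
by split; apply: R1 => // t; have [] := rc t.
Qed.

Lemma path_solution_exists :
  path_solution y l u (fun t => y t + plus_path (clamp T t) - minus_path (clamp T t))
    (plus_path \o clamp T) (minus_path \o clamp T).
Proof.
have pnd := running_max_nd plusP; have mnd := running_max_nd minusP.
have c0 : clamp T 0 = 0 by rewrite clamp_id// lexx ltW.
have inc (f k : R -> R) : is_running_max f k -> k 0 <= 0 -> increasing_from0 T (k \o clamp T).
  move=> fk k0; split.
  - by rewrite /= c0; apply/le_anti; rewrite k0 (running_max_ge0 fk).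
  - by move=> t _; exact: running_max_ge0 fk _.
  - by move=> s t _ st _; apply/(running_max_nd fk)/clamp_nd.
have pc : right_continuous_clamp T plus_path.
  apply: (rcll_right_continuous_clamp T_gt0); apply: nondecreasing_rcll => // t.
  by have [] := rc t.
have mc : right_continuous_clamp T minus_path.
  apply: (rcll_right_continuous_clamp T_gt0); apply: nondecreasing_rcll => // t.
  by have [] := rc t.
have sandwich t : 0 <= t <= T ->
    l t <= y t + plus_path (clamp T t) - minus_path (clamp T t) <= u t.
  by move=> tT; have := fixed_point_sandwich plusP minusP t; rewrite /= clamp_id.
have xc : right_continuous_clamp T
    (fun t => y t + plus_path (clamp T t) - minus_path (clamp T t)).
  move=> t; have cc s : clamp T (clamp T s) = clamp T s by rewrite clamp_id// clamp_itv.
  under eq_fun do rewrite cc.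
  by rewrite cc; apply: cvgB; [apply: cvgD; [exact: yc|exact: pc]|exact: mc].
have [p0 m0] := path_at0.
split=> //.
- by split; [apply: inc plusP p0|apply: inc minusP m0].
- apply: flat_stieltjes0 => //.
  + by move=> t; apply: cvgB => //; exact: lc.
  + by move=> t /sandwich/andP[? _]; rewrite subr_ge0.
  + move=> t tT; rewrite clamp_id// => gt0.
    (* Being strictly above [l] means that the input of the running maximum is strictly below its
       current value, which gives both flatness properties. *)
    have ft : (l \o clamp T) t - (y \o clamp T) t + minus_path t < plus_path t.
      by rewrite /= clamp_id//; lra.
    split; last by move=> e; exact: (running_max_continuous_left plusP ft).
    apply: (running_max_flat_right plusP _ ft).
    by apply: cvgD; [apply: cvgB; [exact: lc|exact: yc]|have [] := rc t].
- apply: flat_stieltjes0 => //.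
  + by move=> t; apply: cvgB => //; exact: uc.
  + by move=> t /sandwich/andP[_ ?]; rewrite subr_ge0.
  + move=> t tT; rewrite clamp_id// => gt0.
    have ft : (y \o clamp T) t - (u \o clamp T) t + plus_path t < minus_path t.
      by rewrite /= clamp_id//; lra.
    split; last by move=> e; exact: (running_max_continuous_left minusP ft).
    apply: (running_max_flat_right minusP _ ft).
    by apply: cvgD; [apply: cvgB; [exact: yc|exact: uc]|have [] := rc t].
Qed.

End existence.
End path_solutions.

(** * Adaptedness *)

Section measurability.
Context {R : realType} {d : measure_display} {Omega : measurableType d}.

Lemma measurable_fun_gt (k : Omega -> R) :
  (forall a, measurable [set w | a < k w]) -> measurable_fun setT k.
Proof.
move=> H; apply: (measurability _ (RGenOInfty.measurableE R)) => //.
move=> _ [_ [a ->] <-]; rewrite setTI; have := H a; congr measurable.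
by apply/seteqP; split=> w /=; rewrite in_itv/= andbT.
Qed.

Lemma measurable_gt (f : Omega -> R) a : measurable_fun setT f ->
  measurable [set w | a < f w].
Proof.
move=> mf; rewrite (_ : [set w | _] = setT `&` f @^-1` `]a, +oo[).
  by apply: mf.
by apply/seteqP; split=> w /=; rewrite in_itv/= andbT => // -[].
Qed.

(** The event that [k] exceeds [a] at [t] is a countable union. Right-continuity replaces a time
    [s < t] by a rational in []s, t[]; the time [t] itself and the floor 0 are listed separately. *)
Lemma running_max_measurable (f k : Omega -> R -> R) t :
  (forall w, is_running_max (f w) (k w)) ->
  (forall w s, f w r @[r --> s^'+] --> f w s) ->
  (forall s, s <= t -> measurable_fun setT (f ^~ s)) ->
  measurable_fun setT (k ^~ t).
Proof.
move=> fk fc mf; apply: measurable_fun_gt => a.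
pose D (q : rat) := if ratr q <= t then [set w | a < f w (ratr q)] else set0.
rewrite (_ : [set w | _] =
    [set w | a < 0] `|` [set w | a < f w t] `|` \bigcup_q D q).
  apply: measurableU; last first.
    apply: bigcupT_measurable_rat => q; rewrite /D; case: ifP => // qt.
    exact/measurable_gt/mf.
  apply: measurableU; last exact/measurable_gt/mf.
  by case: (ltP a 0) => a0; [rewrite (_ : [set _ | _] = setT)|rewrite (_ : [set _ | _] = set0)];
    rewrite //; apply/seteqP; split.
apply/seteqP; split=> [w /= akt|w /= [[a0|aft]|[q _]]]; last 3 first.
- exact: lt_le_trans a0 (running_max_ge0 (fk w) t).
- exact: lt_le_trans aft (running_max_ge (fk w) (lexx t)).
- rewrite /D; case: ifP => //= qt afq; exact: lt_le_trans afq (running_max_ge (fk w) qt).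
apply: contrapT => /not_orP[/not_orP[/negP]]; rewrite -leNgt => a0 /negP.
rewrite -leNgt => fta H; move: akt; apply/negP; rewrite -leNgt; apply/(fk w).
split=> // s; rewrite le_eqVlt => /predU1P[->//|st]; rewrite leNgt; apply/negP => afs.
have [e e0 He] := right_continuous_gt (fc w s) afs.
have sm : s < Num.min t (s + e) by rewrite lt_min st ltrDl.
have [q /itvP sq] := rat_in_itvoo sm.
have : ratr q < Num.min t (s + e) by rewrite sq.
rewrite lt_min => /andP[qt qe]; apply: H; exists q; first exact: I.
by rewrite /D ltW//=; apply: He; rewrite !ltW// sq.
Qed.

Lemma countable_sup_measurable (z : nat -> Omega -> R) (k : Omega -> R) :
  (forall w M, k w <= M <-> forall n, z n w <= M) ->
  (forall n, measurable_fun setT (z n)) -> measurable_fun setT k.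
Proof.
move=> kz mz; apply: measurable_fun_gt => a.
rewrite (_ : [set w | _] = \bigcup_n [set w | a < z n w]).
  by apply: bigcupT_measurable => n; exact: measurable_gt.
apply/seteqP; split=> [w /= akw|w [n _ /= azn]]; last first.
  by apply: lt_le_trans azn _; apply: (kz w (k w)).1.
apply: contrapT => H; move: akw; apply/negP; rewrite -leNgt; apply/kz => n.
by rewrite leNgt; apply/negP => ?; apply: H; exists n.
Qed.

Variables (y l u : Omega -> R -> R) (t : R).
Hypotheses (yc : forall w s, y w r @[r --> s^'+] --> y w s)
  (lc : forall w s, l w r @[r --> s^'+] --> l w s)
  (uc : forall w s, u w r @[r --> s^'+] --> u w s).
Hypotheses (my : forall s, s <= t -> measurable_fun setT (y ^~ s))
  (ml : forall s, s <= t -> measurable_fun setT (l ^~ s))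
  (mu : forall s, s <= t -> measurable_fun setT (u ^~ s)).
Hypothesis sup_ylu : forall w, exists A B, supersolution (y w) (l w) (u w) setT A B.

(** Measurability and right-continuity go through the induction together: the latter reduces the
    next running maximum to rational times. *)
Let iter_measurable n : (forall s, s <= t ->
    measurable_fun setT (fun w => minus_iter (y w) (l w) (u w) n s) /\
    measurable_fun setT (fun w => plus_iter (y w) (l w) (u w) n s)) /\
  (forall w s, minus_iter (y w) (l w) (u w) n r @[r --> s^'+] -->
      minus_iter (y w) (l w) (u w) n s) /\
  (forall w s, plus_iter (y w) (l w) (u w) n r @[r --> s^'+] -->
      plus_iter (y w) (l w) (u w) n s).
Proof.
have pP n' w : is_running_max
    (fun s => l w s - y w s + minus_iter (y w) (l w) (u w) n' s)
    (plus_iter (y w) (l w) (u w) n').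
  have [A [B [ndA ndB A0 B0 AB]]] := sup_ylu w.
  by apply: (plus_iterP ndA ndB A0 B0) => s; exact: AB.
have mP n' w : is_running_max
    (fun s => y w s - u w s + plus_iter (y w) (l w) (u w) n' s)
    (minus_iter (y w) (l w) (u w) n'.+1).
  have [A [B [ndA ndB A0 B0 AB]]] := sup_ylu w.
  by apply: (minus_iterSP ndA ndB A0 B0) => s; exact: AB.
have step n' : (forall s, s <= t ->
      measurable_fun setT (fun w => minus_iter (y w) (l w) (u w) n' s)) ->
    (forall w s, minus_iter (y w) (l w) (u w) n' r @[r --> s^'+] -->
      minus_iter (y w) (l w) (u w) n' s) ->
    (forall s, s <= t ->
      measurable_fun setT (fun w => plus_iter (y w) (l w) (u w) n' s)) /\
    (forall w s, plus_iter (y w) (l w) (u w) n' r @[r --> s^'+] -->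
      plus_iter (y w) (l w) (u w) n' s).
  move=> mm mc; have fc w s : l w r - y w r + minus_iter (y w) (l w) (u w) n' r @[r --> s^'+]
      --> l w s - y w s + minus_iter (y w) (l w) (u w) n' s.
    by apply: cvgD; [exact: cvgB|exact: mc].
  split=> [s st|w]; last exact: (running_max_right_continuous (pP n' w) (fc w)).
  apply: (running_max_measurable (pP n') fc) => r rs; have rt := le_trans rs st.
  by apply: measurable_funD; [apply: measurable_funB; [exact: ml|exact: my]|exact: mm].
suff [H1 H2] : (forall s, s <= t ->
      measurable_fun setT (fun w => minus_iter (y w) (l w) (u w) n s)) /\
    (forall w s, minus_iter (y w) (l w) (u w) n r @[r --> s^'+] -->
      minus_iter (y w) (l w) (u w) n s).
  by have [H3 H4] := step n H1 H2; split=> [s st|]; [split; [exact: H1|exact: H3]|split].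
elim: n => [|n [IHm IHc]]; first by split=> [s _|w s]; [exact: measurable_cst|exact: cvg_cst].
have [pm pc] := step n IHm IHc.
have fc w s : y w r - u w r + plus_iter (y w) (l w) (u w) n r @[r --> s^'+]
    --> y w s - u w s + plus_iter (y w) (l w) (u w) n s.
  by apply: cvgD; [exact: cvgB|exact: pc].
split=> [s st|w]; last exact: (running_max_right_continuous (mP n w) (fc w)).
apply: (running_max_measurable (mP n) fc) => r rs; have rt := le_trans rs st.
by apply: measurable_funD; [apply: measurable_funB; [exact: my|exact: mu]|exact: pm].
Qed.

Lemma plus_reg_measurable : measurable_fun setT (fun w => plus_reg (y w) (l w) (u w) t).
Proof.
apply: (@countable_sup_measurable (fun n w => plus_iter (y w) (l w) (u w) n t)).
  move=> w M; have [A [B [ndA ndB A0 B0 AB]]] := sup_ylu w.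
  by apply: (plus_reg_le ndA ndB A0 B0) => s; exact: AB.
by move=> n; have [/(_ t (lexx t))[]] := iter_measurable n.
Qed.

Lemma minus_reg_measurable : measurable_fun setT (fun w => minus_reg (y w) (l w) (u w) t).
Proof.
apply: (@countable_sup_measurable (fun n w => minus_iter (y w) (l w) (u w) n t)).
  move=> w M; have [A [B [ndA ndB A0 B0 AB]]] := sup_ylu w.
  by apply: (minus_reg_le ndA ndB A0 B0) => s; exact: AB.
by move=> n; have [/(_ t (lexx t))[]] := iter_measurable n.
Qed.

End measurability.

(** * Change of sigma-algebra, and passage from paths to processes *)

Lemma measurable_fun_sub_sigma (R : realType) (Omega : pointedType) (G H : set (set Omega))
    (f : Omega -> R) : G `<=` H ->
  measurable_fun [set: g_sigma_algebraType G] f ->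
  measurable_fun [set: g_sigma_algebraType H] f.
Proof.
move=> GH mf mT B mB; have := mf measurableT B mB.
by apply: sub_sigma_algebra2.
Qed.

Lemma measurable_fun_sub_measurable (R : realType) (d : measure_display)
    (Omega : measurableType d) (G : set (set Omega)) (f : Omega -> R) :
  G `<=` measurable ->
  measurable_fun [set: g_sigma_algebraType G] f -> measurable_fun [set: Omega] f.
Proof.
move=> GH mf mT B mB; have := mf measurableT B mB.
by apply: smallest_sub => //; exact: sigma_algebra_measurable.
Qed.

Theorem theorem1 (R : realType) (d : measure_display) (Omega : measurableType d)
    (P : probability Omega R) (T : R) (F : R -> set (set Omega))
    (Y L U : R -> {RV P >-> R})
    (T_gt0 : 0 < T)
    (F_filtration : filtration T F)
    (F_usual : usual_conditions P T F)
    (Y_rcll : rcll T Y) (L_rcll : rcll T L) (U_rcll : rcll T U)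
    (Y_adapted : adapted T F Y) (L_adapted : adapted T F L)
    (U_adapted : adapted T F U)
    (LYU0 : {ae P, forall w, L 0 w <= Y 0 w <= U 0 w})
    (L_lt_U : {ae P, forall w, forall t, 0 <= t <= T ->
       L t w < U t w /\
       left_limit (fun s => L s w) t < left_limit (fun s => U s w) t}) :
  exists X Kp Km : R -> {RV P >-> R},
    SPR_solution T F Y L U X Kp Km /\
    (forall X' Kp' Km' : R -> {RV P >-> R},
       SPR_solution T F Y L U X' Kp' Km' ->
       [/\ indistinguishable T X X', indistinguishable T Kp Kp' &
           indistinguishable T Km Km']).
Proof.
pose good w := L 0 w <= Y 0 w <= U 0 w /\ forall t, 0 <= t <= T ->
  L t w < U t w /\ left_limit (fun s => L s w) t < left_limit (fun s => U s w) t.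
have good_ae : {ae P, forall w, good w}.
  by move: LYU0 L_lt_U; apply: filterS2 => w.
(* Off the almost sure event [good] the data are replaced by constant paths. *)
pose patch (Z : R -> {RV P >-> R}) (c : R) (w : Omega) (t : R) : R :=
  if `[< good w >] then Z t w else c.
(* The constants [-1 < 0 < 1] give the bad paths strictly separated barriers, so the pathwise
   results apply to every [w]. *)
pose y := patch Y 0; pose l := patch L (-1); pose u := patch U 1.
have patch_good Z c w : good w -> patch Z c w = Z ^~ w.
  by move=> gw; apply/funext => t; rewrite /patch asboolT.
have patch_bad Z c w : ~ good w -> patch Z c w = cst c.
  by move=> gw; apply/funext => t; rewrite /patch asboolF.
have patch_rcll Z c w : rcll T Z -> rcll_path T (patch Z c w).
  move=> Zr; have [gw|gw] := pselect (good w); first by rewrite patch_good//; exact: Zr.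
  by rewrite patch_bad//; split=> t _; [exact: cvg_cst|exists c; exact: cvg_cst].
have left_limit_cst (c t : R) : left_limit (cst c) t = c.
  rewrite /left_limit; case: ifP => // _; apply/cvg_lim => //; exact: cvg_cst.
have lu w t : 0 <= t <= T -> l w t < u w t.
  move=> tT; have [gw|gw] := pselect (good w).
    by rewrite /l /u !patch_good//; have [_ /(_ t tT)[]] := gw.
  by rewrite /l /u !patch_bad//=; lra.
have left_lu w t : 0 < t <= T -> left_limit (l w) t < left_limit (u w) t.
  move=> /andP[t0 tT]; have [gw|gw] := pselect (good w).
    by rewrite /l /u !patch_good//; have [_ /(_ t)] := gw; rewrite tT ltW// => /(_ isT)[].
  by rewrite /l /u !patch_bad// !left_limit_cst; lra.
have lyu0 w : l w 0 <= y w 0 <= u w 0.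
  have [gw|gw] := pselect (good w); first by rewrite /l /u /y !patch_good//; case: gw.
  by rewrite /l /u /y !patch_bad//=; lra.
have yr w : rcll_path T (y w) by exact: patch_rcll.
have lr w : rcll_path T (l w) by exact: patch_rcll.
have ur w : rcll_path T (u w) by exact: patch_rcll.
have [Fsig Fmeas Fnd] := F_filtration.
have cT t := clamp_itv T_gt0 t.
have Fmono s t : s <= t -> F (clamp T s) `<=` F (clamp T t).
  move=> st; have /andP[s0 _] := cT s; have /andP[_ tT] := cT t.
  by apply: Fnd => //; exact: clamp_nd.
(* The complement of [good] is negligible, hence in [F 0] by completeness, hence in every later
   sigma-algebra. Patching therefore preserves adaptedness. *)
have good_F t : measurable ([set w | good w] : set (g_sigma_algebraType (F (clamp T t)))).
  rewrite -[X in measurable X]setCK; apply: measurableC; apply: sub_sigma_algebra.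
  have /andP[c0 c1] := cT t.
  by apply: (Fnd 0 (clamp T t)) => //; apply: F_usual.1; exact: good_ae.
have patch_meas Z c s t : adapted T F Z -> s <= t ->
    measurable_fun [set: g_sigma_algebraType (F (clamp T t))]
      (fun w => patch Z c w (clamp T s)).
  move=> Zad st; apply: measurable_fun_ifT.
  - apply: (measurable_fun_bool true) => //; rewrite setTI.
    have := good_F t; congr measurable; apply/seteqP; split=> w /=.
      by move=> /asboolP.
    by move/asboolP.
  - exact: measurable_fun_sub_sigma (Fmono _ _ st) (Zad _ (cT s)).
  - exact: measurable_cst.
have sup_ylu w := clamped_supersolution T_gt0 (yr w) (lr w) (ur w) (lu w) (left_lu w).
have regF t :
    measurable_fun [set: g_sigma_algebraType (F (clamp T t))]
      (fun w => plus_path T (y w) (l w) (u w) (clamp T t)) /\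
    measurable_fun [set: g_sigma_algebraType (F (clamp T t))]
      (fun w => minus_path T (y w) (l w) (u w) (clamp T t)).
  (* Measurability is required at all [s <= clamp T t], including negative ones, which [clamp] sends
     to 0. *)
  have ct s : s <= clamp T t -> forall Z c, adapted T F Z ->
     measurable_fun [set: g_sigma_algebraType (F (clamp T t))]
      (fun w => patch Z c w (clamp T s)).
    move=> st Z c Zad; have := patch_meas Z c s (clamp T t) Zad st.
    by rewrite (clamp_id (cT t)).
  split.
    apply: (@plus_reg_measurable _ _ (g_sigma_algebraType (F (clamp T t)))
      (fun w => y w \o clamp T) (fun w => l w \o clamp T) (fun w => u w \o clamp T)) => //.
    - by move=> w; exact: rcll_right_continuous_clamp.
    - by move=> w; exact: rcll_right_continuous_clamp.
    - by move=> w; exact: rcll_right_continuous_clamp.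
    - by move=> s st; exact: ct.
    - by move=> s st; exact: ct.
    - by move=> s st; exact: ct.
  apply: (@minus_reg_measurable _ _ (g_sigma_algebraType (F (clamp T t)))
      (fun w => y w \o clamp T) (fun w => l w \o clamp T) (fun w => u w \o clamp T)) => //.
  - by move=> w; exact: rcll_right_continuous_clamp.
  - by move=> w; exact: rcll_right_continuous_clamp.
  - by move=> w; exact: rcll_right_continuous_clamp.
  - by move=> s st; exact: ct.
  - by move=> s st; exact: ct.
  - by move=> s st; exact: ct.
have mkRV (f : Omega -> R) : measurable_fun [set: Omega] f ->
    exists X : {RV P >-> R}, X = f :> (Omega -> R).
  by move=> mf; exists (mfun_Sub (mem_set mf)).
have /choice[Kp KpE] t : exists X : {RV P >-> R},
    X = (fun w => plus_path T (y w) (l w) (u w) (clamp T t)) :> (Omega -> R).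
  by apply/mkRV/(measurable_fun_sub_measurable (Fmeas _ (cT t))); have [] := regF t.
have /choice[Km KmE] t : exists X : {RV P >-> R},
    X = (fun w => minus_path T (y w) (l w) (u w) (clamp T t)) :> (Omega -> R).
  by apply/mkRV/(measurable_fun_sub_measurable (Fmeas _ (cT t))); have [] := regF t.
(* [X] is built from the unpatched [Y]; on [good] it is the pathwise solution. *)
have /choice[X XE] t : exists X : {RV P >-> R}, X = (Y t \+ Kp t \- Km t) :> (Omega -> R).
  by apply: mkRV; apply: measurable_funB => //; apply: measurable_funD.
have path_ae X' Kp' Km' : SPR_solution T F Y L U X' Kp' Km' -> {ae P, forall w,
    path_solution T (Y ^~ w) (L ^~ w) (U ^~ w) (X' ^~ w) (Kp' ^~ w) (Km' ^~ w)}.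
  move=> [_ H1 H2 H3]; apply: filter_app; move: H1 H2 H3; apply: filterS3.
  by move=> w ? ? ? [? ?]; split.
have sol w : path_solution T (y w) (l w) (u w)
    (fun t => y w t + Kp t w - Km t w) (Kp ^~ w) (Km ^~ w).
  have := path_solution_exists T_gt0 (yr w) (lr w) (ur w) (lu w) (left_lu w) (lyu0 w).
  by congr path_solution; apply/funext => t /=; rewrite ?KpE ?KmE.
have solw : {ae P, forall w, path_solution T (Y ^~ w) (L ^~ w) (U ^~ w) (X ^~ w) (Kp ^~ w) (Km ^~ w)}.
  apply: filterS good_ae => w gw; have := sol w.
  rewrite /y /l /u !patch_good//; congr path_solution.
  by apply/funext => t; rewrite XE.
exists X, Kp, Km; split.
  (* [rcll] is a condition on every [w]; the patched construction supplies it off [good] too. *)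
  have rp w : rcll_path T (Kp ^~ w) /\ rcll_path T (Km ^~ w).
    have := path_rcll T_gt0 (yr w) (lr w) (ur w) (lu w) (left_lu w).
    rewrite (_ : Kp ^~ w = plus_path T (y w) (l w) (u w) \o clamp T); last first.
      by apply/funext => t; rewrite KpE.
    rewrite (_ : Km ^~ w = minus_path T (y w) (l w) (u w) \o clamp T)//.
    by apply/funext => t; rewrite KmE.
  split; try by move: solw; apply: filterS => w [].
  split.
  - by move=> w; have [] := rp w.
  - by move=> t tT; rewrite KpE; have [+ _] := regF t; rewrite clamp_id.
  - by move=> w; have [] := rp w.
  - by move=> t tT; rewrite KmE; have [_] := regF t; rewrite clamp_id.
move=> X' Kp' Km' /path_ae sol'.
have uniq : {ae P, forall w, forall t, 0 <= t <= T ->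
    [/\ X t w = X' t w, Kp t w = Kp' t w & Km t w = Km' t w]}.
  move: good_ae solw sol'; apply: filterS3 => w [_ gw] s s' t tT.
  apply: (path_solution_unique T_gt0 (Y_rcll w) (L_rcll w) (U_rcll w) _ s s' tT).
  by move=> r /gw[].
by split; move: uniq; apply: filterS => w H t /H[].
Qed.
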